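(* Let $(\mathcal{E},\mathbb{E},\mathfrak{s})$ be an extriangulated category and let $\mathcal{W}\subsetneq\mathcal{E}$ be a hereditary-like subcategory. Then the quotient category $\mathcal{E}/\mathcal{W}$ is quasi-abelian.
   Context: An extriangulated category $(\mathcal{E},\mathbb{E},\mathfrak{s})$ is meant in the sense of Nakaoka–Palu: $\mathcal{E}$ is an additive category, $\mathbb{E}:\mathcal{E}^{\mathrm{op}}\times\mathcal{E}\to\mathrm{Ab}$ is an additive bifunctor, and $\mathfrak{s}$ is an additive realization assigning to each $\delta\in\mathbb{E}(C,A)$ an equivalence class $[A\to B\to C]$, subject to the Nakaoka–Palu axioms. If $\mathfrak{s}(\delta)=[A\xrightarrow{x}B\xrightarrow{y}C]$, the pair is called an $\mathbb{E}$-triangle, written $A\xrightarrow{x}B\xrightarrow{y}C\overset{\delta}{\dashrightarrow}$ ($\delta$ is often omitted). Subcategories are full and closed under isomorphisms. A left $\mathcal{W}$-approximation of $A$ is a morphism $A\to W$ with $W\in\mathcal{W}$ through which every morphism from $A$ to an object of $\mathcal{W}$ factors; a right $\mathcal{W}$-approximation is defined dually. A subcategory $\mathcal{W}\subsetneq\mathcal{E}$ is hereditary-like if: (1) $\mathcal{W}$ is closed under direct sums and direct summands; (2) for any $A\in\mathcal{E}$ there is an $\mathbb{E}$-triangle $A\xrightarrow{w^A}W^1\to W^2\dashrightarrow$ with $W^1,W^2\in\mathcal{W}$ and $w^A$ a left $\mathcal{W}$-approximation; (3) for any $A\in\mathcal{E}$ there is an $\mathbb{E}$-triangle $W_2\to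 W_1\xrightarrow{w_A}A\dashrightarrow$ with $W_1,W_2\in\mathcal{W}$ and $w_A$ a right $\mathcal{W}$-approximation. $\mathcal{E}/\mathcal{W}$ is the additive ideal quotient: same objects as $\mathcal{E}$, morphisms taken modulo those factoring through an object of $\mathcal{W}$. A quasi-abelian category is an additive category with kernels and cokernels in which kernels are stable under pushouts (the pushout of a kernel along any morphism is a kernel) and cokernels are stable under pullbacks. *)

(* Defs.v *)
From HB Require Import structures.
From mathcomp Require Import all_boot all_order all_algebra.
From mathcomp Require Import boolp.

Set Implicit Arguments.
Unset Strict Implicit.
Unset Printing Implicit Defensive.

Import GRing.Theory.
Local Open Scope ring_scope.
Local Open Scope quotient_scope.

Declare Scope cat_scope.
Delimit Scope cat_scope with cat.
Reserved Notation "g ∘ f" (at level 40, left associativity).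

Record preadditive := Preadditive {
  ob :> Type;
  hom : ob -> ob -> zmodType;
  idm : forall A, hom A A;
  compm : forall A B C, hom B C -> hom A B -> hom A C;
  compmA : forall A B C D (h : hom C D) (g : hom B C) (f : hom A B),
    compm h (compm g f) = compm (compm h g) f;
  comp1m : forall A B (f : hom A B), compm (idm B) f = f;
  compm1 : forall A B (f : hom A B), compm f (idm A) = f;
  compmDl : forall A B C (g g' : hom B C) (f : hom A B),
    compm (g + g') f = compm g f + compm g' f;
  compmDr : forall A B C (g : hom B C) (f f' : hom A B),
    compm g (f + f') = compm g f + compm g f'
}.
Arguments hom {p} A B : rename.
Arguments idm {p} A : rename.

Notation "g ∘ f" := (compm g f) : cat_scope.
Open Scope cat_scope.

Section Preadditive.
Context {C : preadditive}.
Implicit Types A B P Q X Z : C.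

Definition is_iso A B (f : hom A B) : Prop :=
  exists g : hom B A, g ∘ f = idm A /\ f ∘ g = idm B.

Definition is_zero_ob Z : Prop :=
  forall A, (forall f : hom Z A, f = 0) /\ (forall f : hom A Z, f = 0).

Record biprod A B := Biprod {
  bsum :> C;
  in1 : hom A bsum;
  in2 : hom B bsum;
  pr1 : hom bsum A;
  pr2 : hom bsum B;
  pr1_in1 : pr1 ∘ in1 = idm A;
  pr2_in2 : pr2 ∘ in2 = idm B;
  pr1_in2 : pr1 ∘ in2 = 0;
  pr2_in1 : pr2 ∘ in1 = 0;
  biprod_id : in1 ∘ pr1 + in2 ∘ pr2 = idm bsum
}.

Definition bimap A A' B B' (S : biprod A A') (T : biprod B B')
    (f : hom A B) (f' : hom A' B') : hom S T :=
  in1 T ∘ f ∘ pr1 S + in2 T ∘ f' ∘ pr2 S.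

Definition is_kernel K A B (k : hom K A) (f : hom A B) : Prop :=
  f ∘ k = 0 /\
  forall X (g : hom X A), f ∘ g = 0 -> exists! u : hom X K, k ∘ u = g.

Definition is_cokernel A B Q (f : hom A B) (c : hom B Q) : Prop :=
  c ∘ f = 0 /\
  forall X (g : hom B X), g ∘ f = 0 -> exists! u : hom Q X, u ∘ c = g.

Definition is_pushout A B B' P
    (f : hom A B) (g : hom A B') (f' : hom B' P) (g' : hom B P) : Prop :=
  g' ∘ f = f' ∘ g /\
  forall X (u : hom B X) (v : hom B' X), u ∘ f = v ∘ g ->
    exists! w : hom P X, w ∘ g' = u /\ w ∘ f' = v.

Definition is_pullback A B B' P
    (f : hom B A) (g : hom B' A) (f' : hom P B') (g' : hom P B) : Prop :=
  f ∘ g' = g ∘ f' /\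
  forall X (u : hom X B) (v : hom X B'), f ∘ u = g ∘ v ->
    exists! w : hom X P, g' ∘ w = u /\ f' ∘ w = v.

End Preadditive.

Definition additive_cat (C : preadditive) : Prop :=
  (exists Z : C, is_zero_ob Z) /\ forall A B : C, inhabited (biprod A B).

Record quasi_abelian (C : preadditive) : Prop := QuasiAbelian {
  qab_additive : additive_cat C;
  qab_kernels : forall (A B : C) (f : hom A B),
    exists (K : C) (k : hom K A), is_kernel k f;
  qab_cokernels : forall (A B : C) (f : hom A B),
    exists (Q : C) (c : hom B Q), is_cokernel f c;
  qab_pushout : forall (K A X P : C)
      (k : hom K A) (a : hom K X) (k' : hom X P) (a' : hom A P),
    is_pushout k a k' a' ->
    (exists (B : C) (f : hom A B), is_kernel k f) ->
    exists (B : C) (f : hom P B), is_kernel k' f;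
  qab_pullback : forall (Q A X P : C)
      (c : hom A Q) (a : hom X Q) (c' : hom P X) (a' : hom P A),
    is_pullback c a c' a' ->
    (exists (B : C) (f : hom B A), is_cokernel f c) ->
    exists (B : C) (f : hom B P), is_cokernel f c'
}.

(* [ext D A] is E(D, A), contravariant in D and covariant in A; [push a d] is
   a_* d = E(D, a)(d) and [pull c d] is c^* d = E(c, A)(d). *)
Record additive_bifunctor (C : preadditive) := AdditiveBifunctor {
  ext : C -> C -> zmodType;
  push : forall D A A' : C, hom A A' -> ext D A -> ext D A';
  pull : forall D D' A : C, hom D' D -> ext D A -> ext D' A;
  pushD : forall (D A A' : C) (a : hom A A') (d e : ext D A),
    push a (d + e) = push a d + push a e;
  pullD : forall (D D' A : C) (c : hom D' D) (d e : ext D A),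
    pull c (d + e) = pull c d + pull c e;
  push1 : forall (D A : C) (d : ext D A), push (idm A) d = d;
  pull1 : forall (D A : C) (d : ext D A), pull (idm D) d = d;
  push_comp : forall (D A A' A'' : C) (a' : hom A' A'') (a : hom A A')
      (d : ext D A),
    push (a' ∘ a) d = push a' (push a d);
  pull_comp : forall (D D' D'' A : C) (c : hom D' D) (c' : hom D'' D')
      (d : ext D A),
    pull (c ∘ c') d = pull c' (pull c d);
  push_pull : forall (D D' A A' : C) (a : hom A A') (c : hom D' D)
      (d : ext D A),
    push a (pull c d) = pull c (push a d);
  push_addm : forall (D A A' : C) (a a' : hom A A') (d : ext D A),
    push (a + a') d = push a d + push a' d;
  pull_addm : forall (D D' A : C) (c c' : hom D' D) (d : ext D A),
    pull (c + c') d = pull c d + pull c' d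
}.
Arguments ext {C} a D A : rename.

Section Realization.
Context {C : preadditive} (E : additive_bifunctor C).

Definition seq_equiv (A B B' D : C) (x : hom A B) (y : hom B D)
    (x' : hom A B') (y' : hom B' D) : Prop :=
  exists b : hom B B', is_iso b /\ b ∘ x = x' /\ y' ∘ b = y.

(* [s x y d] means that A --x--> B --y--> D belongs to the class s(d). *)
Definition assignment :=
  forall A B D : C, hom A B -> hom B D -> ext E D A -> Prop.

Definition assigns_classes (s : assignment) : Prop :=
  forall (A D : C) (d : ext E D A),
    exists (B : C) (x : hom A B) (y : hom B D),
      forall (B' : C) (x' : hom A B') (y' : hom B' D),
        s A B' D x' y' d <-> seq_equiv x y x' y'.

Definition ext_morphism (A A' D D' : C) (d : ext E D A) (d' : ext E D' A')
    (a : hom A A') (c : hom D D') : Prop :=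
  push a d = pull c d'.

Definition is_realization (s : assignment) : Prop :=
  forall (A A' B B' D D' : C) (d : ext E D A) (d' : ext E D' A')
    (x : hom A B) (y : hom B D) (x' : hom A' B') (y' : hom B' D')
    (a : hom A A') (c : hom D D'),
    s A B D x y d -> s A' B' D' x' y' d' -> ext_morphism d d' a c ->
    exists b : hom B B', b ∘ x = x' ∘ a /\ y' ∘ b = c ∘ y.

(* [e] corresponds to (d, 0, 0, d') under the isomorphism
   E(D + D', A + A') = E(D, A) + E(D, A') + E(D', A) + E(D', A'). *)
Definition is_ext_sum (A A' D D' : C) (SA : biprod A A') (SD : biprod D D')
    (d : ext E D A) (d' : ext E D' A') (e : ext E SD SA) : Prop :=
  [/\ push (pr1 SA) (pull (in1 SD) e) = d,
      push (pr2 SA) (pull (in1 SD) e) = 0,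
      push (pr1 SA) (pull (in2 SD) e) = 0 &
      push (pr2 SA) (pull (in2 SD) e) = d'].

Definition is_additive_realization (s : assignment) : Prop :=
  [/\ is_realization s,
      forall (A D : C) (S : biprod A D), s A S D (in1 S) (pr2 S) 0 &
      forall (A A' B B' D D' : C)
        (SA : biprod A A') (SB : biprod B B') (SD : biprod D D')
        (x : hom A B) (y : hom B D) (x' : hom A' B') (y' : hom B' D')
        (d : ext E D A) (d' : ext E D' A') (e : ext E SD SA),
        s A B D x y d -> s A' B' D' x' y' d' -> is_ext_sum d d' e ->
        s SA SB SD (bimap SA SB x x') (bimap SB SD y y') e].

Definition ET3 (s : assignment) : Prop :=
  forall (A A' B B' D D' : C) (d : ext E D A) (d' : ext E D' A')
    (x : hom A B) (y : hom B D) (x' : hom A' B') (y' : hom B' D')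
    (a : hom A A') (b : hom B B'),
    s A B D x y d -> s A' B' D' x' y' d' -> b ∘ x = x' ∘ a ->
    exists c : hom D D', ext_morphism d d' a c /\ y' ∘ b = c ∘ y.

Definition ET3op (s : assignment) : Prop :=
  forall (A A' B B' D D' : C) (d : ext E D A) (d' : ext E D' A')
    (x : hom A B) (y : hom B D) (x' : hom A' B') (y' : hom B' D')
    (b : hom B B') (c : hom D D'),
    s A B D x y d -> s A' B' D' x' y' d' -> y' ∘ b = c ∘ y ->
    exists a : hom A A', ext_morphism d d' a c /\ b ∘ x = x' ∘ a.

(*  A --f--> B --f'--> D        The rows and the column B -> M -> F are given;
    |        |         |        h, h', d, e and the extension [de''] of H by A
    |        g         d        are produced, together with H.
    |        v         v
    A --h--> M --h'--> H
             |         |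
             g'        e
             v         v
             F ======= F   *)
Definition ET4 (s : assignment) : Prop :=
  forall (A B D M F : C) (f : hom A B) (f' : hom B D)
    (g : hom B M) (g' : hom M F) (de : ext E D A) (de' : ext E F B),
    s A B D f f' de -> s B M F g g' de' ->
    exists (H : C) (h : hom A M) (h' : hom M H) (d : hom D H) (e : hom H F)
      (de'' : ext E H A),
      [/\ h = g ∘ f, h' ∘ g = d ∘ f' & e ∘ h' = g'] /\
      [/\ s A M H h h' de'',
          s D H F d e (push f' de'),
          pull d de'' = de &
          push f de'' = pull e de'].

(*  D --d--> H --e--> F         The middle row and the column F -> B -> M are
    |        |        |         given.
    |        h'       g'
    |        v        v
    D --f'-> A --f--> B
             |        |
             h        g
             v        v
             M ====== M   *)
Definition ET4op (s : assignment) : Prop :=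
  forall (A B D M F : C) (f' : hom D A) (f : hom A B)
    (g' : hom F B) (g : hom B M) (de : ext E B D) (de' : ext E M F),
    s D A B f' f de -> s F B M g' g de' ->
    exists (H : C) (h' : hom H A) (h : hom A M) (d : hom D H) (e : hom H F)
      (de'' : ext E M H),
      [/\ h = g ∘ f, f ∘ h' = g' ∘ e & h' ∘ d = f'] /\
      [/\ s H A M h' h de'',
          s D H F d e (pull g' de),
          push e de'' = de' &
          push d de = pull g de''].

End Realization.

Record extriangulated := Extriangulated {
  ecat :> preadditive;
  ecat_additive : additive_cat ecat;
  eext : additive_bifunctor ecat;
  etri : assignment eext;
  etri_classes : assigns_classes etri;
  etri_additive : is_additive_realization etri;
  etri_ET3 : ET3 etri;
  etri_ET3op : ET3op etri;
  etri_ET4 : ET4 etri;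
  etri_ET4op : ET4op etri
}.

Definition is_triangle (E : extriangulated) (A B D : E)
    (x : hom A B) (y : hom B D) : Prop :=
  exists d : ext (eext E) D A, etri x y d.

Section Approximations.
Context {C : preadditive} (W : C -> Prop).

Definition left_approx (A X : C) (w : hom A X) : Prop :=
  W X /\ forall Y (f : hom A Y), W Y -> exists u : hom X Y, f = u ∘ w.

Definition right_approx (X A : C) (w : hom X A) : Prop :=
  W X /\ forall Y (f : hom Y A), W Y -> exists u : hom Y X, f = w ∘ u.

End Approximations.

Record hereditary_like (E : extriangulated) (W : E -> Prop) : Prop :=
  HereditaryLike {
  hl_iso : forall (A B : E) (f : hom A B), is_iso f -> W A -> W B;
  hl_proper : exists A : E, ~ W A;
  hl_sum : forall (A B : E) (S : biprod A B), W A -> W B -> W S;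
  hl_summand : forall (A B : E) (S : biprod A B), W S -> W A /\ W B;
  hl_left : forall A : E, exists (W1 W2 : E) (w : hom A W1) (v : hom W1 W2),
    [/\ W W1, W W2, is_triangle w v & left_approx W w];
  hl_right : forall A : E, exists (W1 W2 : E) (v : hom W2 W1) (w : hom W1 A),
    [/\ W W1, W W2, is_triangle v w & right_approx W w]
}.

Section CompTheory.
Context {C : preadditive}.
Implicit Types A B D : C.

Lemma comp0m A B D (f : hom A B) : (0 : hom B D) ∘ f = 0.
Proof. by apply: (addrI (0 ∘ f)); rewrite -compmDl !addr0. Qed.

Lemma compm0 A B D (g : hom B D) : g ∘ (0 : hom A B) = 0.
Proof. by apply: (addrI (g ∘ 0)); rewrite -compmDr !addr0. Qed.

Lemma compNm A B D (g : hom B D) (f : hom A B) : (- g) ∘ f = - (g ∘ f).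
Proof. by apply: (addrI (g ∘ f)); rewrite -compmDl !subrr comp0m. Qed.

Lemma compmN A B D (g : hom B D) (f : hom A B) : g ∘ (- f) = - (g ∘ f).
Proof. by apply: (addrI (g ∘ f)); rewrite -compmDr !subrr compm0. Qed.

Lemma compmBl A B D (g g' : hom B D) (f : hom A B) :
  (g - g') ∘ f = g ∘ f - g' ∘ f.
Proof. by rewrite compmDl compNm. Qed.

Lemma compmBr A B D (g : hom B D) (f f' : hom A B) :
  g ∘ (f - f') = g ∘ f - g ∘ f'.
Proof. by rewrite compmDr compmN. Qed.

End CompTheory.

(* Full subcategories containing finite direct sums of their objects: the
   morphisms factoring through such a subcategory form an ideal. *)
Record sum_closed (C : preadditive) := SumClosed {
  sc_ob :> C -> Prop;
  sc_zero : exists2 Z : C, is_zero_ob Z & sc_ob Z;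
  sc_sum : forall A B : C, sc_ob A -> sc_ob B ->
    exists S : biprod A B, sc_ob S
}.

Section Quotient.
Context {C : preadditive} (W : sum_closed C).
Implicit Types A B D : C.

Definition factors A B (f : hom A B) : Prop :=
  exists (X : C) (g : hom A X) (h : hom X B), W X /\ f = h ∘ g.

Definition factor_pred A B : {pred hom A B} := fun f => `[< factors f >].
Arguments factor_pred A B : clear implicits.

Lemma factor_predP A B (f : hom A B) :
  reflect (factors f) (f \in factor_pred A B).
Proof. exact: asboolP. Qed.

Lemma factor_pred_zmod_closed A B : zmod_closed (factor_pred A B).
Proof.
split.
  apply/factor_predP; have [Z _ WZ] := sc_zero W.
  by exists Z, 0, 0; split; rewrite ?comp0m.
move=> f f' /factor_predP[X [g [h [WX ->]]]] /factor_predP[Y [g' [h' [WY ->]]]].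
apply/factor_predP; have [S WS] := sc_sum WX WY.
exists S, (in1 S ∘ g + in2 S ∘ g'), (h ∘ pr1 S - h' ∘ pr2 S); split=> //.
rewrite compmDr !compmBl !compmA -!(compmA _ (pr1 S)) -!(compmA _ (pr2 S)).
by rewrite pr1_in1 pr2_in2 pr1_in2 pr2_in1 !compm0 !compm1 !comp0m subr0 sub0r.
Qed.

Definition factor_zmod A B : zmodClosed (hom A B) :=
  HB.pack (factor_pred A B)
    (GRing.isZmodClosed.Build _ _ (factor_pred_zmod_closed A B)).

Definition quot_hom A B : zmodType := Quotient.quot (factor_zmod A B).

Definition quot_pi A B (f : hom A B) : quot_hom A B := \pi f.

Lemma quot_piP A B (f g : hom A B) :
  quot_pi f = quot_pi g <-> factors (f - g).
Proof.
have eqE := Quotient.idealrBE (factor_zmod A B) f g.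
split=> [/eqP|/factor_predP fg]; last by apply/eqP; rewrite -eqE.
by rewrite /quot_pi -eqE => /factor_predP.
Qed.

Lemma quot_piD A B (f g : hom A B) : quot_pi (f + g) = quot_pi f + quot_pi g.
Proof. exact: (raddfD \pi_(Quotient.quot (factor_zmod A B))). Qed.

Lemma quot_pi_surj A B (f : quot_hom A B) : exists g, f = quot_pi g.
Proof. by exists (repr f); rewrite /quot_pi reprK. Qed.

Definition quot_id A : quot_hom A A := quot_pi (idm A).

Definition quot_comp A B D (g : quot_hom B D) (f : quot_hom A B) :
  quot_hom A D := quot_pi (repr g ∘ repr f).

Lemma quot_compE A B D (g : hom B D) (f : hom A B) :
  quot_comp (quot_pi g) (quot_pi f) = quot_pi (g ∘ f).
Proof.
apply/quot_piP.
set g' := repr _; set f' := repr _.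
have /quot_piP[X [a [b [WX eg]]]] : quot_pi g' = quot_pi g
  by rewrite /quot_pi reprK.
have /quot_piP : quot_pi f' = quot_pi f by rewrite /quot_pi reprK.
move=> [Y [a' [b' [WY ef]]]].
have -> : g' ∘ f' - g ∘ f = g' ∘ b' ∘ a' + b ∘ (a ∘ f).
  by rewrite -compmA -ef compmA -eg compmBl compmBr addrA subrK.
have [_ addF] := GRing.zmod_closedD (factor_pred_zmod_closed A D).
apply/factor_predP; apply: addF; apply/factor_predP.
  by exists Y, a', (g' ∘ b').
by exists X, (a ∘ f), b.
Qed.

Lemma quot_compA A B D F (h : quot_hom D F) (g : quot_hom B D)
  (f : quot_hom A B) :
  quot_comp h (quot_comp g f) = quot_comp (quot_comp h g) f.
Proof.
have [h' ->] := quot_pi_surj h; have [g' ->] := quot_pi_surj g.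
by have [f' ->] := quot_pi_surj f; rewrite !quot_compE compmA.
Qed.

Lemma quot_comp1m A B (f : quot_hom A B) : quot_comp (quot_id B) f = f.
Proof. by have [g ->] := quot_pi_surj f; rewrite quot_compE comp1m. Qed.

Lemma quot_compm1 A B (f : quot_hom A B) : quot_comp f (quot_id A) = f.
Proof. by have [g ->] := quot_pi_surj f; rewrite quot_compE compm1. Qed.

Lemma quot_compDl A B D (g g' : quot_hom B D) (f : quot_hom A B) :
  quot_comp (g + g') f = quot_comp g f + quot_comp g' f.
Proof.
have [k ->] := quot_pi_surj g; have [k' ->] := quot_pi_surj g'.
have [l ->] := quot_pi_surj f.
by rewrite -quot_piD !quot_compE compmDl quot_piD.
Qed.

Lemma quot_compDr A B D (g : quot_hom B D) (f f' : quot_hom A B) :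
  quot_comp g (f + f') = quot_comp g f + quot_comp g f'.
Proof.
have [k ->] := quot_pi_surj g; have [l ->] := quot_pi_surj f.
have [l' ->] := quot_pi_surj f'.
by rewrite -quot_piD !quot_compE compmDr quot_piD.
Qed.

Definition quotient_cat : preadditive :=
  Preadditive quot_compA quot_comp1m quot_compm1 quot_compDl quot_compDr.

End Quotient.

Section HereditaryLike.
Context {E : extriangulated} {W : E -> Prop} (hW : hereditary_like W).

Lemma hereditary_like_zero : exists2 Z : E, is_zero_ob Z & W Z.
Proof.
have [[Z Z0] _] := ecat_additive E; exists Z => //.
have [X [_ [_ [_ [WX _ _ _]]]]] := hl_left hW Z.
have eZ : (0 : hom Z Z) = idm Z.
  exact: esym ((Z0 Z).1 _).
have h0 : (0 : hom X Z) ∘ (0 : hom Z X) = idm Z by rewrite comp0m.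
have e1 : (0 : hom Z X) ∘ (0 : hom X Z) + idm X ∘ idm X = idm X.
  by rewrite comp0m add0r comp1m.
by case: (hl_summand hW (S := Biprod h0 (comp1m _) (comp0m _ _) (compm0 _ _) e1)
  WX).
Qed.

Lemma hereditary_like_sum (A B : E) :
  W A -> W B -> exists S : biprod A B, W S.
Proof.
move=> WA WB; have [S] := (ecat_additive E).2 A B.
by exists S; apply: (hl_sum hW).
Qed.

Definition hereditary_subcat : sum_closed E :=
  SumClosed hereditary_like_zero hereditary_like_sum.

End HereditaryLike.

(* Main.v *)
From HB Require Import structures.
From mathcomp Require Import all_boot all_order all_algebra.
Require Import Defs.

(* For f : A -> B, let d in E(W^2, A) be the class of a triangle
   A -> W^1 -> W^2 with A -> W^1 a left W-approximation; pushing d forward along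
   any map from A to an object of W gives 0. If B --c--> C -> W^2 realizes f_* d,
   this vanishing makes c a cokernel of f in E/W: a map out of B whose composite
   with f factors through W extends along c, and the same applies to the middle
   map B -> W' in the proof of uniqueness. Dually, if e in E(B, W_2) comes from a
   right approximation, a realization W_2 -> K --k--> A of f^* e gives a kernel k.

   For the pushout of such a k along a : K -> X, apply ET4 to the composite of
   W_2 -> K + X with the inflation K + X -> W^1 + X whose class is (1, -a)_* d,
   for a left approximation K -> W^1 -> W^2 of K. It yields
   W_2 -> W^1 + X --h--> P of class t and A + X --p--> P --q--> W^2 of class
   (k, -a)_* d, so p is a cokernel of (k, -a) and P is the pushout. The map
   (f, 0) : A + X -> B extends to g : P -> B, and t = g^* e: the difference
   restricts to 0 along p, hence is q^* u with u in E(W^2, W_2); it also restricts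
   to 0 on W^1, hence u = l_* d for some l : K -> W_2, which is 0. So h, which is
   isomorphic to X -> P in E/W, is a kernel of g. The remaining statements follow
   by passing to the opposite extriangulated category. *)

Set Implicit Arguments.
Unset Strict Implicit.
Unset Printing Implicit Defensive.

Import GRing.Theory.
Local Open Scope ring_scope.

(** * Kernels, pushouts and biproducts *)

Section CategoryFacts.
Context {C : preadditive}.
Implicit Types A B K P X : C.

Lemma is_kernel_iso K K' A B (k : hom K A) (f : hom A B) (i : hom K' K) :
  is_iso i -> is_kernel k f -> is_kernel (k ∘ i) f.
Proof.
move=> [j [ji ij]] [fk ker]; split=> [|X g fg]; first by rewrite compmA fk comp0m.
have [u [ku uniq]] := ker X g fg.
exists (j ∘ u); split=> [|u' ku']; first by rewrite -compmA (compmA i) ij comp1m.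
by rewrite (uniq (i ∘ u')) ?compmA // ji comp1m.
Qed.

Lemma is_kernel_post_iso K A A' B (k : hom K A) (f : hom A B)
    (i : hom A A') (j : hom A' A) :
  j ∘ i = idm A -> i ∘ j = idm A' ->
  is_kernel k f -> is_kernel (i ∘ k) (f ∘ j).
Proof.
move=> ji ij [fk ker]; split=> [|X g fg].
  by rewrite -compmA (compmA j) ji comp1m.
have [|u [ku uniq]] := ker X (j ∘ g); first by rewrite compmA.
exists u; split=> [|u' ku']; first by rewrite -compmA ku compmA ij comp1m.
by apply: uniq; rewrite -ku' !compmA ji comp1m.
Qed.

Lemma kernel_unique K K' A B (k : hom K A) (k' : hom K' A) (f : hom A B) :
  is_kernel k f -> is_kernel k' f -> exists2 i : hom K' K, is_iso i & k ∘ i = k'.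
Proof.
move=> [fk ker] [fk' ker'].
have [i [ki _]] := ker _ _ fk'; have [j [kj _]] := ker' _ _ fk.
exists i => //; exists j; split.
  have [u [_ uniq]] := ker' _ _ fk'.
  by rewrite -(uniq (j ∘ i)) ?(uniq (idm K')) ?compm1 // compmA kj.
have [u [_ uniq]] := ker _ _ fk.
by rewrite -(uniq (i ∘ j)) ?(uniq (idm K)) ?compm1 // compmA ki.
Qed.

Lemma is_pushout_iso K K' A X P (k : hom K A) (a : hom K X) (k' : hom X P)
    (a' : hom A P) (i : hom K' K) :
  is_iso i -> is_pushout k a k' a' -> is_pushout (k ∘ i) (a ∘ i) k' a'.
Proof.
move=> [j [_ ij]] [comm univ]; split=> [|Y u v uv].
  by rewrite !compmA comm.
apply: univ; move/(congr1 (fun z => z ∘ j)): uv.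
by rewrite -!compmA ij !compm1.
Qed.

Lemma pushout_unique K A X P P' (k : hom K A) (a : hom K X)
    (k' : hom X P) (a' : hom A P) (k2 : hom X P') (a2 : hom A P') :
  is_pushout k a k' a' -> is_pushout k a k2 a2 ->
  exists (i : hom P P') (j : hom P' P),
    [/\ j ∘ i = idm P, i ∘ j = idm P' & i ∘ k' = k2].
Proof.
move=> [comm univ] [comm2 univ2].
have [i [[ia ik] _]] := univ _ _ _ comm2.
have [j [[ja jk] _]] := univ2 _ _ _ comm.
exists i, j; split=> //.
  have [u [_ uniq]] := univ _ _ _ comm.
  rewrite -(uniq (j ∘ i)) ?(uniq (idm P)) ?comp1m //.
  by rewrite -!compmA ia ik.
have [u [_ uniq]] := univ2 _ _ _ comm2.
rewrite -(uniq (i ∘ j)) ?(uniq (idm P')) ?comp1m //.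
by rewrite -!compmA ja jk.
Qed.

Lemma bimap_in1 A A' B B' (S : biprod A A') (T : biprod B B')
    (f : hom A B) (f' : hom A' B') : bimap S T f f' ∘ in1 S = in1 T ∘ f.
Proof. by rewrite compmDl -!compmA pr1_in1 pr2_in1 !compm0 compm1 addr0. Qed.

Lemma bimap_in2 A A' B B' (S : biprod A A') (T : biprod B B')
    (f : hom A B) (f' : hom A' B') : bimap S T f f' ∘ in2 S = in2 T ∘ f'.
Proof. by rewrite compmDl -!compmA pr1_in2 pr2_in2 !compm0 compm1 add0r. Qed.

(** Maps out of [S] that kill the difference correspond to pairs [u], [v] with [u ∘ k = v ∘ a]. *)
Lemma cokernel_pushout K A X P (S : biprod A X) (k : hom K A) (a : hom K X)
    (c : hom S P) :
  is_cokernel (in1 S ∘ k - in2 S ∘ a) c ->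
  is_pushout k a (c ∘ in2 S) (c ∘ in1 S).
Proof.
move=> [cs univ]; split=> [|Y u v uv].
  by apply/eqP; rewrite -subr_eq0 -!compmA -compmBr cs.
have [|w [wc uniq]] := univ Y (u ∘ pr1 S + v ∘ pr2 S).
  rewrite compmBr !compmDl !compmA -!(compmA _ (pr1 S)) -!(compmA _ (pr2 S)).
  rewrite pr1_in1 pr2_in1 pr1_in2 pr2_in2 !compm0 !compm1 !comp0m addr0 add0r.
  by rewrite uv subrr.
exists w; split=> [|w' [wu wv]].
  rewrite !compmA wc !compmDl -!compmA pr1_in1 pr2_in1 pr1_in2 pr2_in2.
  by rewrite !compm0 !compm1 addr0 add0r.
apply: uniq; rewrite -wu -wv -(compm1 (w' ∘ c)) -(biprod_id S) compmDr.
by rewrite !compmA.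
Qed.

(** Taking [A] itself as carrier lets triangles be added to A = A -> 0 or 0 -> A = A without
    replacing a term by an isomorphic one. *)
Definition biprod_zero_right A Z (Z0 : is_zero_ob Z) : biprod A Z.
Proof.
apply: (@Biprod C A Z A (idm A) 0 (idm A) 0).
- exact: compm1.
- by rewrite comp0m [RHS]((Z0 Z).1 _).
- exact: compm0.
- exact: comp0m.
- by rewrite compm1 comp0m addr0.
Defined.

Definition biprod_swap A B (S : biprod A B) : biprod B A.
Proof.
apply: (@Biprod C B A S (in2 S) (in1 S) (pr2 S) (pr1 S)).
- exact: pr2_in2.
- exact: pr1_in1.
- exact: pr2_in1.
- exact: pr1_in2.
- by rewrite addrC biprod_id.
Defined.

(* A + B with A embedded as the graph of [-a]; the carrier [bsum] is unchanged. *)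
Definition biprod_twist A B (S : biprod A B) (a : hom A B) : biprod A B.
Proof.
apply: (@Biprod C A B S (in1 S - in2 S ∘ a) (in2 S) (pr1 S)
          (pr2 S + a ∘ pr1 S)).
- by rewrite compmBr compmA pr1_in1 pr1_in2 comp0m subr0.
- by rewrite compmDl pr2_in2 -compmA pr1_in2 compm0 addr0.
- exact: pr1_in2.
- rewrite compmDl !compmBr pr2_in1 -(compmA a) pr1_in1 !compmA pr2_in2.
  by rewrite -(compmA a) pr1_in2 compm0 comp0m comp1m compm1 sub0r subr0 addNr.
- rewrite compmBl compmDr !compmA [in2 S ∘ _ + _]addrC addrA subrK.
  exact: biprod_id.
Defined.

End CategoryFacts.

(** * The opposite extriangulated category *)

(** Kept transparent, so that a statement about [op_cat C] unfolds to its dual in [C]. *)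
Definition op_cat (C : preadditive) : preadditive.
Proof.
apply: (@Preadditive C (fun A B => hom B A) (fun A => idm A)
          (fun A B D g f => f ∘ g)) => *.
- by rewrite compmA.
- exact: compm1.
- exact: comp1m.
- exact: compmDr.
- exact: compmDl.
Defined.

Definition biprod_unop (C : preadditive) (A B : C)
    (S : @biprod (op_cat C) A B) : biprod A B.
Proof.
apply: (@Biprod C A B S (pr1 S) (pr2 S) (in1 S) (in2 S)).
- exact: (pr1_in1 S).
- exact: (pr2_in2 S).
- exact: (pr2_in1 S).
- exact: (pr1_in2 S).
- exact: (biprod_id S).
Defined.

Definition biprod_op (C : preadditive) (A B : C)
    (S : biprod A B) : @biprod (op_cat C) A B.
Proof.
apply: (@Biprod (op_cat C) A B S (pr1 S) (pr2 S) (in1 S) (in2 S)).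
- exact: (pr1_in1 S).
- exact: (pr2_in2 S).
- exact: (pr2_in1 S).
- exact: (pr1_in2 S).
- exact: (biprod_id S).
Defined.

Lemma additive_cat_op (C : preadditive) :
  additive_cat C -> additive_cat (op_cat C).
Proof.
move=> [[Z Z0] sums]; split; first by exists Z => A; have [? ?] := Z0 A.
by move=> A B; have [S] := sums A B; constructor; apply: biprod_op.
Qed.

Definition op_ext (C : preadditive) (E : additive_bifunctor C) :
  additive_bifunctor (op_cat C).
Proof.
apply: (@AdditiveBifunctor (op_cat C) (fun D A => ext E A D)
  (fun D A A' => @pull C E A A' D) (fun D D' A => @push C E A D D')) => *.
- exact: pullD.
- exact: pushD.
- exact: pull1.
- exact: push1.
- exact: pull_comp.
- exact: push_comp.
- by rewrite push_pull.
- exact: pull_addm.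
- exact: push_addm.
Defined.

Section OppositeExtriangulated.
Variable E : extriangulated.

Definition op_tri : assignment (op_ext (eext E)) :=
  fun A B D x y d => @etri E D B A y x d.

Lemma op_tri_classes : assigns_classes op_tri.
Proof.
move=> A D d; have [B [x [y xyP]]] := etri_classes d.
exists B, y, x => B' x' y'; rewrite /op_tri xyP.
split=> [[b [[c [cb bc]] [bx yb]]]|[b [[c [cb bc]] [bx yb]]]].
  exists c; split; [by exists b | split].
    by rewrite /= -yb -compmA bc compm1.
  by rewrite /= -bx compmA cb comp1m.
have {}cb : @compm E _ _ _ b c = idm B := cb.
have {}bc : @compm E _ _ _ c b = idm B' := bc.
have {}bx : @compm E _ _ _ y b = x' := bx.
have {}yb : @compm E _ _ _ b y' = x := yb.
exists c; split; [by exists b | split].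
  by rewrite -yb compmA bc comp1m.
by rewrite -bx -compmA cb compm1.
Qed.

Lemma op_tri_additive : is_additive_realization op_tri.
Proof.
have [real split sum] := etri_additive E; split.
- move=> A A' B B' D D' d d' x y x' y' a c t t' m.
  have [b [bx yb]] := real _ _ _ _ _ _ _ _ _ _ _ _ c a t' t (esym m).
  by exists b.
(* In [E] the reversed split sequence runs from the second summand to the first, hence the swap. *)
- by move=> A D S; apply: (split _ _ (biprod_swap (biprod_unop S))).
- move=> A A' B B' D D' SA SB SD x y x' y' d d' e t t' [e1 e2 e3 e4].
  have := sum _ _ _ _ _ _ (biprod_unop SD) (biprod_unop SB) (biprod_unop SA)
    _ _ _ _ _ _ e t t'.
  rewrite /op_tri /bimap /= !compmA; apply; split; rewrite push_pull.
  + exact: e1.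
  + exact: e3.
  + exact: e2.
  + exact: e4.
Qed.

Lemma op_tri_ET3 : ET3 op_tri.
Proof.
move=> A A' B B' D D' d d' x y x' y' a b t t' m.
have [c [cm yc]] := etri_ET3op t' t m.
by exists c; split; [apply: esym|].
Qed.

Lemma op_tri_ET3op : ET3op op_tri.
Proof.
move=> A A' B B' D D' d d' x y x' y' b c t t' m.
have [a [am ya]] := etri_ET3 t' t m.
by exists a; split; [apply: esym|].
Qed.

Lemma op_tri_ET4 : ET4 op_tri.
Proof.
move=> A B D M F f f' g g' de de' t t'.
have [H [h' [h [d [e [de'' [[c1 c2 c3] [t1 t2 p1 p2]]]]]]]] := etri_ET4op t' t.
exists H, h, h', e, d, de''; split; split.
- exact: c1.
- exact: c2.
- exact: c3.
- exact: t1.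
- exact: t2.
- exact: p1.
- exact: esym p2.
Qed.

Lemma op_tri_ET4op : ET4op op_tri.
Proof.
move=> A B D M F f' f g' g de de' t t'.
have [H [h [h' [d [e [de'' [[c1 c2 c3] [t1 t2 p1 p2]]]]]]]] := etri_ET4 t' t.
exists H, h', h, e, d, de''; split; split.
- exact: c1.
- exact: c2.
- exact: c3.
- exact: t1.
- exact: t2.
- exact: p1.
- exact: esym p2.
Qed.

Definition op_extri : extriangulated :=
  Extriangulated (additive_cat_op (ecat_additive E)) op_tri_classes
    op_tri_additive op_tri_ET3 op_tri_ET3op op_tri_ET4 op_tri_ET4op.

Lemma op_hereditary_like (W : E -> Prop) :
  hereditary_like W -> @hereditary_like op_extri W.
Proof.
move=> hW; split.
- move=> A B f [g [gf fg]]; apply: (hl_iso hW (f := g)).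
  by exists f.
- exact: hl_proper hW.
- by move=> A B S; apply: (hl_sum hW (biprod_unop S)).
- by move=> A B S; apply: (hl_summand hW (S := biprod_unop S)).
- move=> A; have [W1 [W2 [v [w [h1 h2 t [_ ap]]]]]] := hl_right hW A.
  by exists W1, W2, w, v; split.
- move=> A; have [W1 [W2 [w [v [h1 h2 t [_ ap]]]]]] := hl_left hW A.
  by exists W1, W2, v, w; split.
Qed.

End OppositeExtriangulated.

(** * Exact sequences of a triangle *)

Section AdditiveBifunctor.
Context {C : preadditive} (E : additive_bifunctor C).
Implicit Types A D Z : C.

Lemma push_zero D A A' (a : hom A A') : push a (0 : ext E D A) = 0.
Proof. by apply: (addrI (push a 0)); rewrite -pushD !addr0. Qed.

Lemma pull_zero D D' A (c : hom D' D) : pull c (0 : ext E D A) = 0.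
Proof. by apply: (addrI (pull c 0)); rewrite -pullD !addr0. Qed.

Lemma zero_push D A A' (d : ext E D A) : push (0 : hom A A') d = 0.
Proof. by apply: (addrI (push 0 d)); rewrite -push_addm !addr0. Qed.

Lemma zero_pull D D' A (d : ext E D A) : pull (0 : hom D' D) d = 0.
Proof. by apply: (addrI (pull 0 d)); rewrite -pull_addm !addr0. Qed.

Lemma pullB D D' A (c : hom D' D) (d e : ext E D A) :
  pull c (d - e) = pull c d - pull c e.
Proof. by apply/eqP; rewrite -subr_eq opprK -pullD subrK. Qed.

End AdditiveBifunctor.

Section LongExactSequence.
Variable E : extriangulated.
Implicit Types A B D X Y Z : E.

Lemma triangle_to_zero A Z (Z0 : is_zero_ob Z) :
  etri (idm A) (0 : hom A Z) (0 : ext (eext E) Z A).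
Proof.
have [_ split _] := etri_additive E.
exact: split (biprod_zero_right A Z0).
Qed.

Lemma triangle_from_zero A Z (Z0 : is_zero_ob Z) :
  etri (0 : hom Z A) (idm A) (0 : ext (eext E) A Z).
Proof.
have [_ split _] := etri_additive E.
exact: split (biprod_swap (biprod_zero_right A Z0)).
Qed.

(** ET3 maps the triangle to B = B -> 0, whose class is 0, by [x] on first terms. *)
Lemma triangle_push0 A B D (x : hom A B) (y : hom B D) d :
  etri x y d -> push x d = 0.
Proof.
move=> t; have [[Z Z0] _] := ecat_additive E.
have [|c [m _]] := etri_ET3 t (triangle_to_zero B Z0) (a := x) (b := idm B).
  by [].
by rewrite m pull_zero.
Qed.

(** Since [push g d] is 0, [g] induces a map to the split triangle on X + D; the first projection of
    its middle component extends [g]. *)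
Lemma triangle_extend A B D X (x : hom A B) (y : hom B D) d (g : hom A X) :
  etri x y d -> push g d = 0 -> exists g', g' ∘ x = g.
Proof.
move=> t gd; have [real split _] := etri_additive E.
have [S] := (ecat_additive E).2 X D.
have [|b [bx _]] := real _ _ _ _ _ _ _ _ _ _ _ _ g (idm D) t (split _ _ S).
  by rewrite /ext_morphism gd pull1.
by exists (pr1 S ∘ b); rewrite -compmA bx compmA pr1_in1 comp1m.
Qed.

(** ET3 with target 0 -> X = X; the map on third terms is the factor. *)
Lemma triangle_cofactor A B D X (x : hom A B) (y : hom B D) d (u : hom B X) :
  etri x y d -> u ∘ x = 0 -> exists u', u = u' ∘ y.
Proof.
move=> t ux; have [[Z Z0] _] := ecat_additive E.
have [|c [_ cy]] := etri_ET3 t (triangle_from_zero X Z0) (a := 0) (b := u).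
  by rewrite ux compm0.
by exists c; rewrite -cy comp1m.
Qed.

End LongExactSequence.

Section LongExactSequenceDual.
Variable E : extriangulated.
Implicit Types A B D X Y Z : E.

Lemma triangle_lift A B D X (x : hom A B) (y : hom B D) d (g : hom X D) :
  etri x y d -> pull g d = 0 -> exists g', y ∘ g' = g.
Proof. exact: (@triangle_extend (op_extri E) D B A X y x d g). Qed.

Lemma triangle_pull0 A B D (x : hom A B) (y : hom B D) d :
  etri x y d -> pull y d = 0.
Proof. exact: (@triangle_push0 (op_extri E) D B A y x d). Qed.

Lemma ext_realized A D (d : ext (eext E) D A) :
  exists (B : E) (x : hom A B) (y : hom B D), etri x y d.
Proof.
have [B [x [y xyP]]] := etri_classes d; exists B, x, y; apply/xyP.
exists (idm B); rewrite comp1m compm1; split=> //.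
by exists (idm B); rewrite comp1m.
Qed.

(** A lift of [y] to the middle term of a realization of [tau] gives, by ET3op, a map of triangles
    over [idm D]; its first component is [l]. *)
Lemma triangle_push_lift A B D Z (x : hom A B) (y : hom B D) d
    (tau : ext (eext E) D Z) :
  etri x y d -> pull y tau = 0 -> exists l, tau = push l d.
Proof.
move=> t ytau; have [N [j [z tz]]] := ext_realized tau.
have [b yb] := triangle_lift tz ytau.
have [|l [m _]] := etri_ET3op t tz (b := b) (c := idm D); first by rewrite comp1m.
by exists l; rewrite m pull1.
Qed.

(** ET4op gives [dH] with [push i th = pull y dH]. The triangle starting with [i] has class
    [pull x th], which is 0, so [i] has a retraction [r], and pushing [dH] along [r] gives [tau]. *)
Lemma triangle_pull_lift A B D Z (x : hom A B) (y : hom B D) d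
    (th : ext (eext E) B Z) :
  etri x y d -> pull x th = 0 -> exists tau, th = pull y tau.
Proof.
move=> t xth; have [N [j [z tz]]] := ext_realized th.
have [H [h' [h [i [e [dH [_ [_ tH _ iH]]]]]]]] := etri_ET4op tz t.
have [|r ri] := triangle_extend (g := idm Z) tH; first by rewrite xth push_zero.
by exists (push r dH); rewrite -push_pull -iH -push_comp ri push1.
Qed.

End LongExactSequenceDual.

(** * The quotient by W *)

Section QuotientFacts.
Context {C : preadditive} (W : sum_closed C).
Implicit Types A B D X : C.
Local Notation Q := (quotient_cat W).
Local Notation pi f := (@quot_pi C W _ _ f).

Lemma quot_pi_comp A B D (g : hom B D) (f : hom A B) :
  @compm Q _ _ _ (pi g) (pi f) = pi (g ∘ f).
Proof. exact: quot_compE. Qed.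

Lemma quot_pi0 A B : pi (0 : hom A B) = 0.
Proof. by apply: (addrI (pi 0)); rewrite -quot_piD !addr0. Qed.

Lemma quot_piB A B (f g : hom A B) : pi (f - g) = pi f - pi g.
Proof. by apply/eqP; rewrite -subr_eq opprK -quot_piD subrK. Qed.

Lemma quot_pi_eq0 A B (f : hom A B) : pi f = 0 <-> factors W f.
Proof. by rewrite -quot_pi0 quot_piP subr0. Qed.

Definition quot_biprod A B (S : biprod A B) : @biprod Q A B.
Proof.
apply: (@Biprod Q A B S (pi (in1 S)) (pi (in2 S)) (pi (pr1 S)) (pi (pr2 S)));
  rewrite !quot_pi_comp.
- by rewrite pr1_in1.
- by rewrite pr2_in2.
- by rewrite pr1_in2 quot_pi0.
- by rewrite pr2_in1 quot_pi0.
- by rewrite -quot_piD biprod_id.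
Defined.

Lemma quot_additive : additive_cat C -> additive_cat Q.
Proof.
move=> [[Z Z0] sums]; split; last first.
  by move=> A B; have [S] := sums A B; constructor; apply: quot_biprod.
exists Z => A; split=> f; have [g ->] := quot_pi_surj f.
  by rewrite ((Z0 A).1 g) quot_pi0.
by rewrite ((Z0 A).2 g) quot_pi0.
Qed.

End QuotientFacts.

(** * Universal properties along a fully faithful functor surjective on objects *)

Section FullyFaithful.
Context (C D : preadditive) (F0 : C -> D).
Variable F : forall A B : C, hom A B -> hom (F0 A) (F0 B).
Hypothesis F_surj : forall Z : D, exists A, F0 A = Z.
Hypothesis F_full : forall (A B : C) (g : hom (F0 A) (F0 B)), exists f, F f = g.
Hypothesis F_faithful : forall A B : C, injective (@F A B).
Hypothesis F_zero : forall A B : C, F (0 : hom A B) = 0.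
Hypothesis F_comp : forall (A B X : C) (g : hom B X) (f : hom A B),
  F (g ∘ f) = F g ∘ F f.

Lemma is_kernel_image (K A B : C) (k : hom K A) (f : hom A B) :
  is_kernel k f -> is_kernel (F k) (F f).
Proof.
move=> [fk ker]; split=> [|Z]; first by rewrite -F_comp fk F_zero.
have [X <-] := F_surj Z => g'; have [g <-] := F_full g'.
rewrite -F_comp -F_zero => /F_faithful /ker [u [ku uniq]].
exists (F u); split=> [|v']; first by rewrite -F_comp ku.
by have [v <-] := F_full v'; rewrite -F_comp => /F_faithful /uniq ->.
Qed.

Lemma is_kernel_reflect (K A B : C) (k : hom K A) (f : hom A B) :
  is_kernel (F k) (F f) -> is_kernel k f.
Proof.
move=> [fk ker]; split=> [|X g fg].
  by apply: F_faithful; rewrite F_comp fk F_zero.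
have [|u' [ku uniq]] := ker _ (F g); first by rewrite -F_comp fg F_zero.
have [u eu] := F_full u'; exists u; split=> [|v kv].
  by apply: F_faithful; rewrite F_comp eu.
by apply: F_faithful; rewrite eu; apply: uniq; rewrite -F_comp kv.
Qed.

Lemma is_cokernel_image (A B X : C) (f : hom A B) (c : hom B X) :
  is_cokernel f c -> is_cokernel (F f) (F c).
Proof.
move=> [cf coker]; split=> [|Z]; first by rewrite -F_comp cf F_zero.
have [Y <-] := F_surj Z => g'; have [g <-] := F_full g'.
rewrite -F_comp -F_zero => /F_faithful /coker [u [uc uniq]].
exists (F u); split=> [|v']; first by rewrite -F_comp uc.
by have [v <-] := F_full v'; rewrite -F_comp => /F_faithful /uniq ->.
Qed.

Lemma is_pushout_reflect (K A X P : C) (k : hom K A) (a : hom K X)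
    (k' : hom X P) (a' : hom A P) :
  is_pushout (F k) (F a) (F k') (F a') -> is_pushout k a k' a'.
Proof.
move=> [comm univ]; split=> [|Y u v uv].
  by apply: F_faithful; rewrite !F_comp.
have [|w' [[wu wv] uniq]] := univ _ (F u) (F v); first by rewrite -!F_comp uv.
have [w ew] := F_full w'; exists w; split=> [|z [zu zv]].
  by split; apply: F_faithful; rewrite F_comp ew.
by apply: F_faithful; rewrite ew; apply: uniq; rewrite -!F_comp zu zv.
Qed.

End FullyFaithful.

(** * Cokernels in the quotient *)

Section Cokernels.
Context (E : extriangulated) (W : E -> Prop) (hW : hereditary_like W).
Local Notation HW := (hereditary_subcat hW).
Local Notation Q := (quotient_cat HW).
Local Notation pi f := (@quot_pi _ HW _ _ f).

Lemma left_approx_push0 (A U V X : E) (w : hom A U) (v : hom U V)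
    (d : ext (eext E) V A) (k : hom A X) :
  etri w v d -> left_approx W w -> W X -> push k d = 0.
Proof.
move=> t [_ ap] WX; have [u ->] := ap X k WX.
by rewrite push_comp (triangle_push0 t) push_zero.
Qed.

Lemma quot_is_cokernel (A B D U V : E) (f : hom A B) (w : hom A U)
    (v : hom U V) (d : ext (eext E) V A) (c : hom B D) (q : hom D V) :
  etri w v d -> left_approx W w -> W V -> etri c q (push f d) ->
  @is_cokernel Q _ _ _ (pi f) (pi c).
Proof.
move=> t ap WV tc; split.
  have [real _ _] := etri_additive E.
  (* The map of triangles over [idm V] exhibits [c ∘ f] as [b ∘ w], which factors through [U]. *)
  have [|b [bw _]] := real _ _ _ _ _ _ _ _ _ _ _ _ f (idm V) t tc.
    by rewrite /ext_morphism pull1.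
  by rewrite quot_pi_comp; apply/quot_pi_eq0; exists U, w, b; split; case: ap.
move=> X g'; have [g ->] := quot_pi_surj g'.
rewrite quot_pi_comp => /quot_pi_eq0 [Y [k [h [WY gf]]]].
have [|u uc] := triangle_extend (g := g) tc.
  by rewrite -push_comp gf push_comp (left_approx_push0 _ t) ?push_zero.
exists (pi u); split=> [|z']; first by rewrite quot_pi_comp uc.
have [z ->] := quot_pi_surj z'; rewrite quot_pi_comp -uc.
move=> /esym /quot_piP; rewrite -compmBl => -[Y' [k' [h' [WY' uz]]]].
(* For uniqueness, extend [k'] along [c]: the corrected difference kills [c], hence factors through
   [V], so [u - z] is a sum of two maps factoring through W. *)
have [|l lc] := triangle_extend (g := k') tc.
  by rewrite -push_comp (left_approx_push0 _ t).
have [|r er] := triangle_cofactor (u := u - z - h' ∘ l) tc.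
  by rewrite compmBl uz -compmA lc subrr.
apply/subr0_eq; rewrite -quot_piB.
have -> : u - z = r ∘ q + h' ∘ l by rewrite -er subrK.
rewrite quot_piD (_ : pi (r ∘ q) = 0) ?add0r; last first.
  by apply/quot_pi_eq0; exists V, q, r.
by apply/quot_pi_eq0; exists Y', l, h'.
Qed.

Lemma quot_has_cokernels (A B : Q) (f : hom A B) :
  exists (X : Q) (c : hom B X), is_cokernel f c.
Proof.
have [f' ->] := quot_pi_surj f.
have [U [V [w [v [WU WV [d t] ap]]]]] := hl_left hW A.
have [X [c [q tc]]] := ext_realized (push f' d).
by exists X, (pi c); apply: quot_is_cokernel t ap WV tc.
Qed.

End Cokernels.

(** * Kernels in the quotient, by duality *)

Section Duality.
Context (E : extriangulated) (W : E -> Prop) (hW : hereditary_like W).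
Local Notation HW := (hereditary_subcat hW).
Local Notation hW' := (@op_hereditary_like E W hW).
Local Notation HW' := (hereditary_subcat hW').
Local Notation Q := (quotient_cat HW).
Local Notation Q' := (quotient_cat HW').

(* The functor from E^op/W to (E/W)^op; the two categories are isomorphic but not
   convertible. *)
Definition quot_dual (A B : Q') (f : hom A B) : @hom (op_cat Q) A B :=
  @quot_pi E HW B A (repr f).

Lemma factors_op (A B : E) (f : hom B A) :
  @factors (op_extri E) HW' A B f <-> factors HW f.
Proof. by split=> [] [X [g [h [WX ->]]]]; exists X, h, g. Qed.

Lemma quot_dual_pi (A B : E) (f : hom B A) :
  quot_dual (@quot_pi (op_extri E) HW' A B f) = @quot_pi E HW B A f.
Proof.
apply/quot_piP/factors_op; apply/(@quot_piP _ HW').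
by rewrite {1}/quot_pi reprK.
Qed.

Lemma quot_dual_full (A B : Q') (g : @hom (op_cat Q) A B) :
  exists f : hom A B, quot_dual f = g.
Proof.
have [g' ->] := quot_pi_surj g.
by exists (@quot_pi (op_extri E) HW' A B g'); rewrite quot_dual_pi.
Qed.

Lemma quot_dual_inj (A B : Q') : injective (@quot_dual A B).
Proof.
move=> f g; have [f' ->] := quot_pi_surj f; have [g' ->] := quot_pi_surj g.
rewrite !quot_dual_pi => /quot_piP/factors_op fg.
exact/quot_piP.
Qed.

Lemma quot_dual0 (A B : Q') : quot_dual (0 : hom A B) = 0.
Proof. by rewrite -[in LHS]quot_pi0 quot_dual_pi quot_pi0. Qed.

Lemma quot_dual_comp (A B X : Q') (g : hom B X) (f : hom A B) :
  quot_dual (g ∘ f) = quot_dual g ∘ quot_dual f.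
Proof.
have [f' ->] := quot_pi_surj f; have [g' ->] := quot_pi_surj g.
rewrite quot_pi_comp !quot_dual_pi; apply: esym; exact: quot_pi_comp.
Qed.

Lemma quot_dual_surj (Z : op_cat Q) :
  exists A : Q', (fun X : Q' => X : op_cat Q) A = Z.
Proof. by exists Z. Qed.

Lemma quot_is_kernel (A B D U V : E) (f : hom A B) (v : hom V U)
    (w : hom U B) (d : ext (eext E) B V) (k : hom D A) (j : hom V D) :
  etri v w d -> right_approx W w -> W V -> etri j k (pull f d) ->
  @is_kernel Q _ _ _ (@quot_pi _ HW _ _ k) (@quot_pi _ HW _ _ f).
Proof.
move=> t [WU ap] WV tk; rewrite -!quot_dual_pi.
apply: (@is_cokernel_image Q' (op_cat Q) _ quot_dual quot_dual_surj
  quot_dual_full quot_dual_inj quot_dual0 quot_dual_comp B A D).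
by apply: (@quot_is_cokernel (op_extri E) W hW' B A D U V f w v d k j).
Qed.

Lemma right_approx_pull0 (B U V X : E) (v : hom V U) (w : hom U B)
    (d : ext (eext E) B V) (k : hom X B) :
  etri v w d -> right_approx W w -> W X -> pull k d = 0.
Proof.
move=> t [WU ap] WX.
by apply: (@left_approx_push0 (op_extri E) W B U V X w v d k).
Qed.

End Duality.

(** * Pushouts of kernels *)

Section Pushouts.
Context (E : extriangulated) (W : E -> Prop) (hW : hereditary_like W).
Local Notation HW := (hereditary_subcat hW).
Local Notation Q := (quotient_cat HW).
Local Notation pi f := (@quot_pi _ HW _ _ f).

(** This is the sum with the triangle 0 -> X = X. *)
Lemma triangle_add_id_right (V K A X : E) (j : hom V K) (k : hom K A)
    (th : ext (eext E) A V) (SK : biprod K X) (SA : biprod A X) :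
  etri j k th ->
  etri (in1 SK ∘ j) (bimap SK SA k (idm X)) (pull (pr1 SA) th).
Proof.
move=> t; have [[Z Z0] _] := ecat_additive E.
have [_ _ sum] := etri_additive E.
have := sum _ _ _ _ _ _ (biprod_zero_right V Z0) SK SA _ _ _ _ _ _
  (pull (pr1 SA) th) t (triangle_from_zero X Z0).
rewrite /(bimap (biprod_zero_right _ _)) /= !compm0 addr0 compm1; apply.
split; rewrite /= ?push1 ?zero_push // -!pull_comp.
- by rewrite pr1_in1 pull1.
- by rewrite pr1_in2 zero_pull.
Qed.

(** This is the sum with the triangle X = X -> 0. *)
Lemma triangle_add_id_left (K U V X : E) (w : hom K U) (v : hom U V)
    (d : ext (eext E) V K) (SK : biprod K X) (SU : biprod U X) :
  etri w v d ->
  etri (bimap SK SU w (idm X)) (v ∘ pr1 SU) (push (in1 SK) d).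
Proof.
move=> t; have [[Z Z0] _] := ecat_additive E.
have [_ _ sum] := etri_additive E.
have := sum _ _ _ _ _ _ SK SU (biprod_zero_right V Z0) _ _ _ _ _ _
  (push (in1 SK) d) t (triangle_to_zero X Z0).
rewrite /(bimap _ (biprod_zero_right _ _)) /= comp1m !comp0m addr0; apply.
split; rewrite /= ?pull1 ?zero_pull ?push_zero // -!push_comp.
- by rewrite pr1_in1 push1.
- by rewrite pr2_in1 zero_push.
Qed.

Lemma quot_pushout_kernel (A B K U V X : E) (f : hom A B) (v : hom V U)
    (w : hom U B) (e : ext (eext E) B V) (j : hom V K) (k : hom K A)
    (a : hom K X) :
  etri v w e -> right_approx W w -> W V -> etri j k (pull f e) ->
  exists (P : E) (k' : hom X P) (a' : hom A P) (g : hom P B),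
    @is_pushout Q _ _ _ _ (pi k) (pi a) (pi k') (pi a') /\
    @is_kernel Q _ _ _ (pi k') (pi g).
Proof.
move=> te ape WV tk.
have [U1 [V1 [w1 [v1 [WU1 WV1 [d td] apd]]]]] := hl_left hW K.
have [SK] := (ecat_additive E).2 K X.
have [SA] := (ecat_additive E).2 A X.
have [SU] := (ecat_additive E).2 U1 X.
have t1 := triangle_add_id_right SK SA tk.
(* The twist turns the class into [push (in1 SK - in2 SK ∘ a) d] but keeps the carrier of [SK], so
   ET4 can compose with [t1]. *)
have t2 := triangle_add_id_left (biprod_twist SK a) SU td.
have [P [x [h [p [q [th [[_ hg qh] [th_tri p_tri pth _]]]]]]]] := etri_ET4 t1 t2.
set s := in1 SA ∘ k - in2 SA ∘ a.
have ps : etri p q (push s d).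
  move: p_tri; rewrite -push_comp /= compmBr compmA bimap_in1 bimap_in2.
  by rewrite compm1.
(* Thus [f ∘ k] factors through [U] in W and kills [d], which is what extending [f ∘ pr1 SA] along
   [p] requires. *)
have [r fk] : exists r, w ∘ r = f ∘ k.
  by apply: triangle_lift te _; rewrite pull_comp (triangle_pull0 tk).
have [|g gp] := triangle_extend (g := f ∘ pr1 SA) ps.
  rewrite -push_comp /s compmBr !compmA -!(compmA f) pr1_in1 pr1_in2.
  rewrite comp1m comp0m compm0 subr0 -fk.
  by rewrite push_comp (left_approx_push0 _ td apd) ?push_zero; case: ape.
have hU : q ∘ (h ∘ in1 SU) = v1.
  by rewrite compmA qh -compmA pr1_in1 compm1.
have th_eq : th = pull g e.
  have [|tau etau] := triangle_pull_lift (th := th - pull g e) ps.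
    by rewrite pullB pth -!pull_comp gp subrr.
  (* By [hU], pulling [tau] back along [v1] restricts [th - pull g e] to [U1]: [th] vanishes along
     [h], and [e] along any map from an object of W. *)
  have [|l el] := triangle_push_lift (tau := tau) td.
    rewrite -hU pull_comp -etau pullB pull_comp (triangle_pull0 th_tri).
    rewrite pull_zero -pull_comp.
    by rewrite (right_approx_pull0 _ te ape) ?subrr.
  apply: subr0_eq; rewrite etau el.
  by rewrite (left_approx_push0 _ td apd) ?pull_zero.
(* The twist leaves the second injection unchanged, so [hg] can be evaluated on [X]. *)
have hX : h ∘ in2 SU = p ∘ in2 SA.
  have e2 := bimap_in2 (biprod_twist SK a) SU w1 (idm X).
  have e3 := bimap_in2 SK SA k (idm X).
  by rewrite -[LHS]compm1 -compmA -e2 compmA hg -compmA e3 compm1.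
exists P, (p ∘ in2 SA), (p ∘ in1 SA), g; split.
  rewrite -!quot_pi_comp.
  apply: (cokernel_pushout (S := quot_biprod HW SA)).
  rewrite !quot_pi_comp -quot_piB.
  exact: quot_is_cokernel td apd WV1 ps.
(* As [U1] lies in W, [in2 SU] becomes invertible in the quotient, with inverse [pr2 SU]. *)
rewrite -hX -quot_pi_comp; apply: is_kernel_iso.
  exists (pi (pr2 SU)); rewrite !quot_pi_comp pr2_in2; split=> //.
  apply/quot_piP; rewrite -(biprod_id SU) opprD addrCA subrr addr0.
  exists U1, (- pr1 SU), (in1 SU); split=> //; by rewrite compmN.
by apply: quot_is_kernel te ape WV _; rewrite -th_eq; apply: th_tri.
Qed.

End Pushouts.

(** * Stability of kernels and cokernels, and the conclusion *)

Section Main.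
Context (E : extriangulated) (W : E -> Prop) (hW : hereditary_like W).
Local Notation HW := (hereditary_subcat hW).
Local Notation Q := (quotient_cat HW).

(** Kernels and pushouts are unique up to isomorphism, so the given square can be compared with the
    one built from a realized kernel of [f]. *)
Lemma quot_kernel_pushout (K A X P : Q) (k : hom K A) (a : hom K X)
    (k' : hom X P) (a' : hom A P) :
  is_pushout k a k' a' ->
  (exists (B : Q) (f : hom A B), is_kernel k f) ->
  exists (B : Q) (f : hom P B), is_kernel k' f.
Proof.
move=> po [B [f kf]]; have [f0 ef] := quot_pi_surj f.
have [U [V [v [w [WU WV [e te] ap]]]]] := hl_right hW B.
have [K0 [j [k0 tk]]] := ext_realized (pull f0 e).
have := quot_is_kernel hW te ap WV tk; rewrite -ef => kf0.
have [i iso_i ki] := kernel_unique kf kf0.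
have [a0 ea] := quot_pi_surj (a ∘ i).
have [P0 [k1 [a1 [g [po0 kg]]]]] := quot_pushout_kernel hW a0 te ap WV tk.
have po1 := is_pushout_iso iso_i po.
rewrite -ea -ki in po0.
have [u [u' [uu' u'u <-]]] := pushout_unique po0 po1.
by exists B, ((quot_pi HW g : @hom Q _ _) ∘ u'); apply: is_kernel_post_iso.
Qed.

End Main.

Theorem theorem1p2 (E : extriangulated) (W : E -> Prop)
    (hW : hereditary_like W) :
  quasi_abelian (quotient_cat (hereditary_subcat hW)).
Proof.
pose hW' := op_hereditary_like hW.
pose F := @quot_dual E W hW.
have F_surj := @quot_dual_surj E W hW; have F_full := @quot_dual_full E W hW.
have F_inj := @quot_dual_inj E W hW; have F0 := @quot_dual0 E W hW.
have F_comp := @quot_dual_comp E W hW.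
split.
- exact: quot_additive (ecat_additive E).
- move=> A B f; have [f' <-] := F_full B A f.
  have [K [k kf]] := quot_has_cokernels f'.
  exists K, (F _ _ k).
  exact: (is_cokernel_image F_surj F_full F_inj F0 F_comp kf).
- exact: quot_has_cokernels.
- exact: quot_kernel_pushout.
(* In [op_cat] the pullback is a pushout and [c] a kernel; lifting along [F] reduces the claim to
   [quot_kernel_pushout] for the opposite extriangulated category. *)
- move=> X A Y P c a c' a' po [B [f cf]].
  have [c0 ec] := F_full X A c; have [a0 ea] := F_full X Y a.
  have [c0' ec'] := F_full Y P c'; have [a0' ea'] := F_full A P a'.
  have [f0 efs] := F_full A B f.
  subst c a c' a' f.
  have po0 := is_pushout_reflect F_full F_inj F_comp po.
  have kf0 := is_kernel_reflect F_full F_inj F0 F_comp cf.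
  have [|D [g kg]] := quot_kernel_pushout po0; first by exists B, f0.
  exists D, (F _ _ g).
  exact: (is_kernel_image F_surj F_full F_inj F0 F_comp kg).
Qed.
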